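(* For every permutation $\pi$ of $\{1,\dots,n\}$, $$\operatorname{bc}(\pi)\ \ge\ \max\Big(\tfrac{\operatorname{bp}(\pi)}{3},\ \operatorname{des}(\pi),\ \tfrac{\operatorname{gap}(\pi)}{2},\ \operatorname{des}(\pi^{-1}),\ \tfrac{\operatorname{gap}(\pi^{-1})}{2}\Big).$$
   Context: Extend $\pi$ by $\pi_0=0$, $\pi_{n+1}=n+1$. A block move $(i,j,k)$ with $1\le i\le j<k\le n$ exchanges the adjacent blocks $\pi_i\dots\pi_j$ and $\pi_{j+1}\dots\pi_k$; it is monotone if $\pi_q>\pi_r$ for all $i\le q\le j<r\le k$. $\operatorname{bc}(\pi)$ is the minimum number of monotone block moves needed to transform $\pi$ into the identity permutation. For $0\le i\le n$, the adjacent pair $(\pi_i,\pi_{i+1})$ is a breakpoint if $\pi_{i+1}\ne\pi_i+1$; a breakpoint is a descent if $\pi_i>\pi_{i+1}$ and a gap otherwise. $\operatorname{bp}(\pi),\operatorname{des}(\pi),\operatorname{gap}(\pi)$ are the numbers of breakpoints, descents, gaps. $\pi^{-1}$ is the inverse permutation ($\pi^{-1}_{\pi_i}=i$), with the same conventions. *)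

(* Defs.v *)
From mathcomp Require Import all_boot all_fingroup zify.

Set Implicit Arguments.
Unset Strict Implicit.
Unset Printing Implicit Defensive.

(* The permutation pi of {1, ..., n} is given by s : 'S_n acting on            *)
(* {0, ..., n-1}: pi_(x+1) = s x + 1.  Thus word s is pi_1 ... pi_n, the       *)
(* identity is 1%g, and pi^-1 is s^-1%g.                                       *)
Definition word n (s : 'S_n) : seq nat := [seq (s x).+1 | x <- enum 'I_n].

(* pi_i for 0 <= i <= n + 1, with pi_0 = 0 and pi_(n+1) = n + 1. *)
Definition ext n (s : 'S_n) (i : nat) : nat :=
  nth 0 (0 :: rcons (word s) n.+1) i.

Definition block_move (i j k : nat) (w : seq nat) : seq nat :=
  take i.-1 w ++ drop j (take k w) ++ drop i.-1 (take j w) ++ drop k w.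

Definition monotone n (s : 'S_n) (i j k : nat) : bool :=
  [forall q : 'I_n.+1, forall r : 'I_n.+1,
     [&& i <= q, q <= j, j < r & r <= k] ==> (ext s r < ext s q)].

Definition mono_move n (s t : 'S_n) : bool :=
  [exists i : 'I_n.+1, exists j : 'I_n.+1, exists k : 'I_n.+1,
    [&& 1 <= i, i <= j, j < k, monotone s i j k &
        word t == block_move i j k (word s)]].

Definition sortable_in n (s : 'S_n) (m : nat) : bool :=
  [exists p : m.-tuple 'S_n, path (@mono_move n) s p && (last s p == 1%g)].

Lemma size_word n (s : 'S_n) : size (word s) = n.
Proof. by rewrite size_map size_enum_ord. Qed.

Lemma nth_word n (s : 'S_n) (x : 'I_n) : nth 0 (word s) x = (s x).+1.
Proof. by rewrite (nth_map x) ?nth_ord_enum // size_enum_ord. Qed.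

Lemma ext_word n (s : 'S_n) (x : 'I_n) : ext s x.+1 = (s x).+1.
Proof. by rewrite /ext /= nth_rcons size_word ltn_ord nth_word. Qed.

Lemma mono_move_tperm n (s : 'S_n) (x y : 'I_n) :
  y = x.+1 :> nat -> s y < s x -> mono_move s (tperm x y * s)%g.
Proof.
move=> yx lts; have yn := ltn_ord y; have x1n : x.+1 < n by rewrite -yx.
apply/existsP; exists (inord x.+1); apply/existsP; exists (inord x.+1).
apply/existsP; exists (inord x.+2); rewrite !inordK ?ltnS //; try lia.
rewrite !leqnn /=; apply/andP; split.
  apply/forallP=> q; apply/forallP=> r; apply/implyP=> /and4P[h1 h2 h3 h4].
  have -> : nat_of_ord q = x.+1 by lia.
  have -> : nat_of_ord r = y.+1 by lia.
  by rewrite !ext_word.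
have szw := size_word s.
apply/eqP/(@eq_from_nth _ 0).
  by rewrite size_word /block_move /= !size_cat !size_drop !size_takel
    ?szw //; lia.
move=> i; rewrite size_word => lin.
rewrite (nth_word _ (Ordinal lin)) permM /block_move /=.
rewrite !nth_cat !size_drop !size_takel ?szw //; try lia.
have nw z : nth 0 (word s) (nat_of_ord z) = (s z).+1 by exact: nth_word.
case: tpermP => [/(congr1 val)|/(congr1 val)|/eqP + /eqP]; rewrite -?val_eqE /=.
- move=> ->; rewrite ltnn subnn (_ : 0 < x.+2 - x.+1); last lia.
  by rewrite nth_drop addn0 nth_take // -yx nw.
- move=> ->; rewrite yx (_ : x.+1 < x = false); last lia.
  have -> : x.+2 - x.+1 = 1 by lia.
  have -> : x.+1 - x = 1 by lia.
  by rewrite /= nth_drop addn0 nth_take // nw.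
move=> /eqP ix /eqP iy; have wi := nw (Ordinal lin); rewrite /= in wi.
case: ltnP => h; first by rewrite nth_take.
rewrite (_ : i - x < _ = false); last lia.
rewrite (_ : i - x - _ < _ = false); last lia.
by rewrite nth_drop -wi; congr nth; lia.
Qed.

Lemma no_descent_id n (s : 'S_n) :
  (forall x y : 'I_n, y = x.+1 :> nat -> s x <= s y) -> s = 1%g.
Proof.
move=> h; have srt : sorted leq (word s).
  apply/(sortedP 0) => i; rewrite size_word => hi.
  have hi' : i < n by lia.
  by rewrite (nth_word _ (Ordinal hi)) (nth_word _ (Ordinal hi')) ltnS h.
have w1 : word (1%g : 'S_n) = iota 1 n.
  rewrite /word (eq_map (g := S \o val)); last by move=> x; rewrite perm1.
  by rewrite map_comp val_enum_ord (iotaDl 1 0 n).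
have e : word s = word (1%g : 'S_n).
  apply: (sorted_eq leq_trans anti_leq srt); [by rewrite w1 iota_sorted|].
  apply: uniq_perm.
  - by rewrite map_inj_uniq ?enum_uniq // => x y [] /val_inj /perm_inj.
  - by rewrite w1 iota_uniq.
  move=> v; apply/mapP/mapP => -[x _ ->].
    by exists (s x); rewrite ?mem_enum ?perm1.
  by exists ((s^-1)%g x); rewrite ?mem_enum // permKV perm1.
apply/permP => x; apply/val_inj/succn_inj.
by rewrite /= -!nth_word e.
Qed.

Lemma sortable n (s : 'S_n) : exists m, sortable_in s m.
Proof.
pose phi (t : 'S_n) := \sum_(x < n) x * t x.
have phiB t : phi t <= \sum_(x < n) x * n.
  by apply: leq_sum => x _; rewrite leq_mul2l ltnW ?orbT.
have [d] := ubnP (\sum_(x < n) x * n - phi s).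
elim: d s => // d IH s hd.
have [/existsP[x /existsP[y /andP[/eqP yx lts]]]|nd] :=
  boolP [exists x : 'I_n, exists y : 'I_n, (y == x.+1 :> nat) && (s y < s x)];
  last first.
  exists 0; apply/existsP; exists [tuple]; rewrite /= (no_descent_id (s := s)) //.
  move=> x y yx; rewrite leqNgt; apply/negP => lts; case/negP: nd.
  by apply/existsP; exists x; apply/existsP; exists y; rewrite yx eqxx.
have mv := mono_move_tperm yx lts.
set t := (tperm x y * s)%g in mv.
have nxy : y != x by rewrite -val_eqE /= yx; lia.
have lt_phi : phi s < phi t.
  rewrite /phi (bigD1 x) //= (bigD1 y) //= [ltnRHS](bigD1 x) //=.
  rewrite [in ltnRHS](bigD1 y) //= /t !permM tpermL tpermR !addnA.
  rewrite [X in _ < _ + X](eq_bigr (fun z : 'I_n => z * s z)).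
    by rewrite ltn_add2r yx; nia.
  by move=> z /andP[zx zy]; rewrite permM tpermD // eq_sym.
have [|m /existsP[p /andP[pp lp]]] := IH t.
  by have := phiB t; lia.
by exists m.+1; apply/existsP; exists [tuple of t :: p]; rewrite /= mv pp.
Qed.

(* A minimum exists because exchanging the entries of a descent is the monotone *)
(* block move (i, i, i + 1), and sorting by such exchanges terminates.         *)
Definition bc n (s : 'S_n) : nat := ex_minn (sortable s).

Definition breakpoint n (s : 'S_n) (i : nat) : bool :=
  ext s i.+1 != (ext s i).+1.

Definition descent n (s : 'S_n) (i : nat) : bool :=
  breakpoint s i && (ext s i.+1 < ext s i).

Definition is_gap n (s : 'S_n) (i : nat) : bool :=
  breakpoint s i && ~~ descent s i.

Definition bp n (s : 'S_n) : nat := #|[set i : 'I_n.+1 | breakpoint s i]|.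
Definition des n (s : 'S_n) : nat := #|[set i : 'I_n.+1 | descent s i]|.
Definition gap n (s : 'S_n) : nat := #|[set i : 'I_n.+1 | is_gap s i]|.

(* Main.v *)
Require Import Defs.
From mathcomp Require Import all_boot all_order all_fingroup all_algebra.
From mathcomp Require Import zify.
Set Implicit Arguments.
Unset Strict Implicit.
Unset Printing Implicit Defensive.

Import Order.TTheory GRing.Theory Num.Theory.

(** Each of the five quantities vanishes at the identity, so it suffices to
    bound its decrease under one monotone block move [a A B b -> a B A b], where
    every entry of [A] exceeds every entry of [B].  Only the adjacencies
    [(a, A_1)], [(A_last, B_1)], [(B_last, b)] are destroyed, which gives 3 for
    [bp]; the middle one is a descent, which gives 2 for [gap]; and if the first
    or the third is a descent then so is [(a, B_1)] or [(A_last, b)], which gives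
    1 for [des].  In the inverse, the only pairs [v, v+1] whose relative order
    changes have [v] in [B] and [v+1] in [A], so [v = max B] and [v+1 = min A]:
    one descent is lost.  A gap of the inverse is lost only when [v, v+1] become
    adjacent at [(a, B_1)] or [(A_last, b)], since at [(B_last, A_1)] the pair was
    a descent before. *)

(** * Counting tools *)

Lemma bc_lower_bound n (f : 'S_n -> nat) c (s : 'S_n) :
  f 1%g = 0 -> (forall u t : 'S_n, mono_move u t -> f u <= f t + c) ->
  f s <= c * bc s.
Proof.
move=> f1 fmove; rewrite /bc; case: ex_minnP => m /existsP[p /andP[pp lp]] _.
rewrite -(size_tuple p); elim: {p}(tval p) s pp lp => [|t p IH] s /=.
  by move=> _ /eqP->; rewrite f1.
case/andP=> /fmove h pp lp; rewrite mulnSr.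
apply: leq_trans h _; rewrite leq_add2r; exact: IH.
Qed.

(** Used for all five quantities: [f] says where an adjacency goes under the move, and [D] collects
    the few adjacencies that may be lost. *)
Lemma card_shift_le n (P Q D : pred nat) (f : nat -> nat) :
  {homo f : p / p <= n} -> {in [pred p | p <= n] &, injective f} ->
  (forall p, p <= n -> P p -> ~~ D p -> Q (f p)) ->
  #|[set p : 'I_n.+1 | P p]|
    <= #|[set p : 'I_n.+1 | Q p]| + #|[set p : 'I_n.+1 | D p]|.
Proof.
move=> fn injf fPQ; pose g (p : 'I_n.+1) : 'I_n.+1 := inord (f p).
have gE (p : 'I_n.+1) : g p = f p :> nat.
  by rewrite inordK // ltnS fn // -ltnS.
have injg : injective g.
  move=> p q /(congr1 val); rewrite /= !gE => /injf pq.
  by apply/val_inj/pq; rewrite inE -ltnS.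
rewrite -(cardsID [set p : 'I_n.+1 | D p]) addnC leq_add //; last first.
  by rewrite subset_leq_card ?subsetIr.
rewrite -(card_imset _ injg); apply/subset_leq_card/subsetP => y /imsetP[p + ->].
rewrite !inE gE => /andP[Dp Pp]; apply: fPQ => //; by rewrite -ltnS.
Qed.

Lemma card_mem_le n (r : seq nat) : #|[set p : 'I_n | (p : nat) \in r]| <= size r.
Proof.
rewrite cardE -(size_map val); apply: uniq_leq_size.
  by rewrite map_inj_uniq ?enum_uniq //; exact: val_inj.
by move=> _ /mapP[p + ->]; rewrite mem_enum inE.
Qed.

(** * The extended permutation and its inverse *)

Lemma ext0 n (s : 'S_n) : ext s 0 = 0.
Proof. by []. Qed.

Lemma ext_last n (s : 'S_n) : ext s n.+1 = n.+1.
Proof. by rewrite /ext /= nth_rcons size_word ltnn eqxx. Qed.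

Variant ext_spec n (s : 'S_n) : nat -> nat -> Prop :=
| ExtFirst : ext_spec s 0 0
| ExtMiddle (x : 'I_n) : ext_spec s x.+1 (s x).+1
| ExtLast : ext_spec s n.+1 n.+1.

Lemma extP n (s : 'S_n) p : p <= n.+1 -> ext_spec s p (ext s p).
Proof.
case: p => [|p] hp; first by rewrite ext0; constructor.
have [lt|ge] := ltnP p n.
  by rewrite (ext_word s (Ordinal lt)); exact: (ExtMiddle s (Ordinal lt)).
have -> : p = n by lia.
by rewrite ext_last; constructor.
Qed.

Lemma ext_le n (s : 'S_n) p : p <= n.+1 -> ext s p <= n.+1.
Proof. by case/(extP s) => // x; rewrite ltnS ltnW. Qed.

Lemma extK n (s : 'S_n) p : p <= n.+1 -> ext (s^-1)%g (ext s p) = p.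
Proof. by case/(extP s) => [|x|]; rewrite ?ext_last // ext_word permK. Qed.

Lemma extVK n (s : 'S_n) p : p <= n.+1 -> ext s (ext (s^-1)%g p) = p.
Proof. by move=> hp; rewrite -{1}[s]invgK extK. Qed.

Lemma ext1 n p : p <= n.+1 -> ext (1%g : 'S_n) p = p.
Proof. by case/(extP (1%g : 'S_n)) => // x; rewrite perm1. Qed.

Lemma breakpoint1 n (i : 'I_n.+1) : breakpoint (1%g : 'S_n) i = false.
Proof. by rewrite /breakpoint !ext1 ?eqxx //; have := ltn_ord i; lia. Qed.

Lemma bp1 n : bp (1%g : 'S_n) = 0.
Proof. by apply: eq_card0 => i; rewrite inE breakpoint1. Qed.

Lemma des1 n : des (1%g : 'S_n) = 0.
Proof. by apply: eq_card0 => i; rewrite inE /descent breakpoint1. Qed.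

Lemma gap1 n : gap (1%g : 'S_n) = 0.
Proof. by apply: eq_card0 => i; rewrite inE /is_gap breakpoint1. Qed.

Lemma descentE n (s : 'S_n) i : descent s i = (ext s i.+1 < ext s i).
Proof. by rewrite /descent /breakpoint; lia. Qed.

Lemma is_gapE n (s : 'S_n) i : i <= n -> is_gap s i = ((ext s i).+1 < ext s i.+1).
Proof.
move=> hi; have : ext s i != ext s i.+1.
  apply/eqP=> /(congr1 (ext (s^-1)%g)); rewrite !extK; lia.
by rewrite /is_gap descentE /breakpoint; lia.
Qed.

Ltac if_lia := repeat (case: ifP => ?); lia.

(** The entry at position [p] after the block move [(i, j, k)] was at position
    [block_pos i j k p] before it. *)
Definition block_pos (i j k p : nat) : nat :=
  if (p < i) || (k < p) then p
  else if p < i + (k - j) then p + (j.+1 - i) else p - (k - j).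

(** The predecessors turn positions counted from 1 into sequence indices; the cases are the prefix,
    the two exchanged blocks and the suffix. *)
Lemma nth_block_move i j k (w : seq nat) p :
  1 <= i -> i <= j -> j < k -> k <= size w -> 1 <= p -> p <= size w ->
  nth 0 (block_move i j k w) p.-1 = nth 0 w (block_pos i j k p).-1.
Proof.
move=> i0 ij jk kw p0 pw; rewrite /block_move /block_pos !nth_cat.
rewrite !size_drop !size_takel //; try lia.
have [lt|ge] := ltnP p.-1 i.-1.
  by rewrite nth_take // ifT //; lia.
have [lt1|ge1] := ltnP (p.-1 - i.-1) (k - j).
  rewrite ifF; last lia.
  rewrite ifT; last lia.
  by rewrite nth_drop nth_take; [congr nth|]; lia.
have [lt2|ge2] := ltnP (p.-1 - i.-1 - (k - j)) (j - i.-1).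
  rewrite ifF; last lia.
  rewrite ifF; last lia.
  by rewrite nth_drop nth_take; [congr nth|]; lia.
by rewrite ifT; [rewrite nth_drop; congr nth|]; lia.
Qed.

Lemma mono_moveP n (s t : 'S_n) : mono_move s t ->
  exists i j k, [/\ [/\ 1 <= i, i <= j, j < k & k <= n],
    forall q r, i <= q <= j -> j < r <= k -> ext s r < ext s q &
    forall p, p <= n.+1 -> ext t p = ext s (block_pos i j k p)].
Proof.
case/existsP=> i /existsP[j /existsP[k /and5P[i0 ij jk mon /eqP wt]]].
have kn := ltn_ord k.
exists i, j, k; split => [|q r|p hp]; first by split; lia.
  move=> /andP[iq qj] /andP[jr rk].
  have qn : q < n.+1 by lia.
  have rn : r < n.+1 by lia.
  have /implyP := forallP (forallP mon (Ordinal qn)) (Ordinal rn).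
  by apply; rewrite iq qj jr rk.
have nthE (u : 'S_n) q : 1 <= q -> q <= n -> ext u q = nth 0 (word u) q.-1.
  by case: q => // q _ qn; rewrite /ext /= nth_rcons size_word qn.
(* The end positions [0] and [n.+1] lie outside [word]; [block_pos] fixes them because [1 <= i] and
   [k <= n]. *)
have [|] := boolP (1 <= p <= n); last first.
  move=> h; have [->|->] : p = 0 \/ p = n.+1 by lia.
    by rewrite /block_pos i0.
  by rewrite /block_pos [k < _]ltnS (_ : k <= n) ?orbT ?ext_last //; lia.
case/andP=> p0 pn; rewrite !nthE //; try by rewrite /block_pos; if_lia.
by rewrite wt nth_block_move ?size_word //; lia.
Qed.

(** * Loss under a single monotone move *)

Section Move.

Variables (n : nat) (s t : 'S_n) (i j k : nat).
Hypotheses (i0 : 1 <= i) (ij : i <= j) (jk : j < k) (kn : k <= n).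
Hypothesis mon : forall q r, i <= q <= j -> j < r <= k -> ext s r < ext s q.
Hypothesis tE : forall p, p <= n.+1 -> ext t p = ext s (block_pos i j k p).

(* The three junctions [i-1], [j], [k] of [s] go to the three junctions of [t];
   every other adjacent pair goes to its new place. *)
Let shift (p : nat) : nat :=
  if (p < i) || (k <= p) then p
  else if p < j then p + (k - j)
  else if p == j then i.-1 + (k - j) else p - (j.+1 - i).

Let shift_le : {homo shift : p / p <= n}.
Proof. by move=> p pn; rewrite /shift; if_lia. Qed.

Let shift_inj : {in [pred p | p <= n] &, injective shift}.
Proof. by move=> p q; rewrite !inE /shift; if_lia. Qed.

Let shift_off p : p <= n -> p != i.-1 -> p != j -> p != k ->
  ext t (shift p) = ext s p /\ ext t (shift p).+1 = ext s p.+1.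
Proof.
move=> pn p1 p2 p3.
by rewrite !tE; [split; congr ext| |]; rewrite /shift; repeat (case: ifP => ?);
  rewrite /block_pos; if_lia.
Qed.

Let ext_junctions :
  [/\ ext t i.-1 = ext s i.-1, ext t i = ext s j.+1, ext t k = ext s j
    & ext t k.+1 = ext s k.+1].
Proof. by rewrite !tE; try lia; split; congr ext; rewrite /block_pos; if_lia. Qed.

(** Inverts [tE], so that the inverses can be compared through the positions of a value before and
    after the move. *)
Let posE v : v <= n.+1 ->
  ext (s^-1)%g v = block_pos i j k (ext (t^-1)%g v).
Proof.
move=> vn; have le := ext_le (t^-1)%g vn.
have {1}-> : v = ext s (block_pos i j k (ext (t^-1)%g v)) by rewrite -tE // extVK.
by rewrite extK //; move: le; rewrite /block_pos; if_lia.
Qed.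

Lemma bp_move_aux : bp s <= bp t + 3.
Proof.
apply: leq_trans (leq_add (leqnn _) (card_mem_le n.+1 [:: i.-1; j; k])).
apply: (card_shift_le shift_le shift_inj) => p pn /=; rewrite orbF !negb_or.
move=> bps /and3P[p1 p2 p3].
by rewrite /breakpoint; have [| | | |-> ->] := @shift_off p.
Qed.

Lemma des_move_aux : des s <= des t + 1.
Proof.
apply: leq_trans (leq_add (leqnn _) (card_mem_le n.+1 [:: j])).
apply: (card_shift_le shift_le shift_inj) => p pn /=; rewrite orbF !descentE => + p2.
have [e1 e2 e3 e4] := ext_junctions.
(* With [A], [B] the blocks and [a], [b] their outer neighbours, a descent here gives a > A_1 > B_1,
   and one at [k] gives A_last > B_last > b. *)
have [->|p1] := eqVneq p i.-1.
  have -> : shift i.-1 = i.-1 by rewrite /shift; if_lia.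
  by rewrite prednK // e1 e2; have := @mon i j.+1; lia.
have [->|p3] := eqVneq p k.
  have -> : shift k = k by rewrite /shift; if_lia.
  by rewrite e3 e4; have := @mon j k; lia.
by have [| | | |-> ->] := @shift_off p.
Qed.

Lemma gap_move_aux : gap s <= gap t + 2.
Proof.
apply: leq_trans (leq_add (leqnn _) (card_mem_le n.+1 [:: i.-1; k])).
apply: (card_shift_le shift_le shift_inj) => p pn /=.
rewrite orbF negb_or !is_gapE ?shift_le // => + /andP[p1 p3].
have [->|p2] := eqVneq p j; first by have := @mon j j.+1; lia.
by have [| | | |-> ->] := @shift_off p.
Qed.

Lemma desV_move_aux : des (s^-1)%g <= des (t^-1)%g + 1.
Proof.
(* Adjacencies of the inverse are indexed by values, which the move leaves in place, so the
   injection is [id] and only the lost descents need counting. *)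
pose D v := descent (s^-1)%g v && ~~ descent (t^-1)%g v.
suff cD : #|[set v : 'I_n.+1 | D v]| <= 1.
  apply: leq_trans (leq_add (leqnn _) cD).
  by apply: (@card_shift_le _ _ _ _ id) => // v _ sv; rewrite /D sv negbK.
have DP (v : 'I_n.+1) : D v ->
    j < ext (s^-1)%g v <= k /\ i <= ext (s^-1)%g v.+1 <= j.
  by have vn := ltn_ord v; rewrite /D !descentE !posE /block_pos; try if_lia.
apply/card_le1_eqP => v w; rewrite !inE => /DP[v1 v2] /DP[w1 w2]; apply: val_inj => /=.
(* Monotonicity gives [w < v.+1] and [v < w.+1], hence [v = w]. *)
have := mon v2 w1; have := mon w2 v1.
by rewrite !extVK; have := ltn_ord v; have := ltn_ord w; lia.
Qed.

Lemma gapV_move_aux : gap (s^-1)%g <= gap (t^-1)%g + 2.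
Proof.
(* The exceptions are the values that end up just before B_1 and just before [b], namely [a] and
   A_last. *)
apply: leq_trans
  (leq_add (leqnn _) (card_mem_le n.+1 [:: ext t i.-1; ext t k])).
apply: (@card_shift_le _ _ _ _ id) => // v vn gs /=; apply: contraR => gt.
have [e|e] : ext (t^-1)%g v = i.-1 \/ ext (t^-1)%g v = k.
- have ne : ext (t^-1)%g v != ext (t^-1)%g v.+1.
    by apply/eqP=> /(congr1 (ext t)); rewrite !extVK; lia.
  (* The gap could turn into a descent only with [v] in [A] and [v.+1] in [B], which monotonicity
     forbids; so [v] and [v.+1] have become adjacent. *)
  have := @mon (ext (s^-1)%g v) (ext (s^-1)%g v.+1).
  rewrite !extVK ?(leqW vn) //; move: gs gt ne.
  by rewrite !is_gapE // !posE ?(leqW vn) // /block_pos; if_lia.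
- by rewrite -e extVK ?eqxx //; lia.
- by rewrite -e extVK ?eqxx ?orbT //; lia.
Qed.

End Move.

Lemma bp_move n (s t : 'S_n) : mono_move s t -> bp s <= bp t + 3.
Proof. by case/mono_moveP=> i [j [k [[? ? ? ?] _ ?]]]; apply: (@bp_move_aux _ _ _ i j k). Qed.

Lemma des_move n (s t : 'S_n) : mono_move s t -> des s <= des t + 1.
Proof. by case/mono_moveP=> i [j [k [[? ? ? ?] ? ?]]]; apply: (@des_move_aux _ _ _ i j k). Qed.

Lemma gap_move n (s t : 'S_n) : mono_move s t -> gap s <= gap t + 2.
Proof. by case/mono_moveP=> i [j [k [[? ? ? ?] ? ?]]]; apply: (@gap_move_aux _ _ _ i j k). Qed.

Lemma desV_move n (s t : 'S_n) :
  mono_move s t -> des (s^-1)%g <= des (t^-1)%g + 1.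
Proof. by case/mono_moveP=> i [j [k [[? ? ? ?] ? ?]]]; apply: (@desV_move_aux _ _ _ i j k). Qed.

Lemma gapV_move n (s t : 'S_n) :
  mono_move s t -> gap (s^-1)%g <= gap (t^-1)%g + 2.
Proof. by case/mono_moveP=> i [j [k [[? ? ? ?] ? ?]]]; apply: (@gapV_move_aux _ _ _ i j k). Qed.

Local Open Scope ring_scope.

Theorem theorem1 (n : nat) (s : 'S_n) :
  Num.max ((bp s)%:R / 3%:R)
    (Num.max (des s)%:R
      (Num.max ((gap s)%:R / 2%:R)
        (Num.max (des (s^-1)%g)%:R
                 ((gap (s^-1)%g)%:R / 2%:R)))) <= (bc s)%:R :> rat.
Proof.
have hbp := bc_lower_bound s (bp1 n) (@bp_move n).
have hdes := bc_lower_bound s (des1 n) (@des_move n).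
have hgap := bc_lower_bound s (gap1 n) (@gap_move n).
have hdesV : (des (s^-1)%g <= 1 * bc s)%N.
  apply: (@bc_lower_bound _ (fun u => des (u^-1)%g)) (@desV_move n).
  by rewrite invg1 des1.
have hgapV : (gap (s^-1)%g <= 2 * bc s)%N.
  apply: (@bc_lower_bound _ (fun u => gap (u^-1)%g)) (@gapV_move n).
  by rewrite invg1 gap1.
rewrite !ge_max !ler_pdivrMr ?ltr0n // -!natrM !ler_nat; lia.
Qed.
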